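(* The $\mathbb{F}_1$-module $\mathrm{Part}$ of partitions of finite sets is a proper submodule of the $\mathbb{F}_1$-module $\mathrm{Dynk}$ of Dynkin systems on finite sets; that is, the injections $\Sigma\colon\mathrm{Part}(\underline{n}_+)\hookrightarrow\mathrm{Dynk}(\underline{n}_+)$, sending a partition to the $\sigma$-algebra generated by its blocks, assemble into an objectwise injective morphism of $\mathbb{F}_1$-modules $\mathrm{Part}\to\mathrm{Dynk}$ which is not an isomorphism.
   Context: Let $\mathcal{F}in_*$ be the category with objects $\underline{n}_+=\{0,1,\ldots,n\}$, $n\ge 0$, pointed at $0$, and basepoint-preserving functions. An $\mathbb{F}_1$-module is a functor $X\colon\mathcal{F}in_*\to\mathcal{S}et_*$ to pointed sets with $X(\underline{0}_+)$ a one-element set; morphisms are natural transformations. $\mathrm{Dynk}(\underline{n}_+)$ is the set of Dynkin systems on $\underline{n}_+$, i.e. families $X$ of subsets of $\underline{n}_+$ containing $\varnothing$ and closed under complements and under unions of disjoint pairs (since the set is finite, closure under countable disjoint unions is automatic), pointed at the full power set. For a pointed function $\phi\colon\underline{n}_+\to\underline{m}_+$, $\mathrm{Dynk}(\phi)(X)=\{A\subseteq\underline{m}_+:\phi^{-1}(A)\in X\}$. $\mathrm{Part}(\underline{n}_+)$ is the set of partitions of $\underline{n}_+$ into nonempty disjoint blocks, pointed at the partition all of whose blocks are singletons. For a pointed function $\phi\colon\underline{n}_+\to\underline{m}_+$, $\mathrm{Part}(\phi)(P)$ is the partition associated to the smallest equivalence relation on $\underline{m}_+$ containing the image under $\phi\times\phi$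 of the equivalence relation associated to $P$. For a partition $P$ of $\underline{n}_+$, $\Sigma(P)$ is the family of all unions of (possibly empty) collections of blocks of $P$, which is the $\sigma$-algebra generated by the blocks. *)

(* Defs.v *)
From mathcomp Require Import all_boot.

Set Implicit Arguments.
Unset Strict Implicit.
Unset Printing Implicit Defensive.

(* The object n_+ = {0, ..., n} of Fin_* is 'I_n.+1, pointed at ord0. *)

Record fin_map (n m : nat) := FinMap {
  fin_fun :> {ffun 'I_n.+1 -> 'I_m.+1};
  fin_fun0 : fin_fun ord0 = ord0 }.

Lemma fin_id_subproof n : [ffun x : 'I_n.+1 => x] ord0 = ord0.
Proof. by rewrite ffunE. Qed.

Definition fin_id n : fin_map n n := FinMap (fin_id_subproof n).

Lemma fin_comp_subproof n m p (g : fin_map m p) (f : fin_map n m) :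
  [ffun x => g (f x)] ord0 = ord0.
Proof. by rewrite ffunE !fin_fun0. Qed.

Definition fin_comp n m p (g : fin_map m p) (f : fin_map n m) : fin_map n p :=
  FinMap (fin_comp_subproof g f).

Record pointed_set := PointedSet {
  pcarrier :> Type;
  point : pcarrier }.

Record f1_module := F1Module {
  f1_obj :> nat -> pointed_set;
  f1_map : forall n m, fin_map n m -> f1_obj n -> f1_obj m;
  f1_map_point : forall n m (phi : fin_map n m),
    f1_map phi (point (f1_obj n)) = point (f1_obj m);
  f1_map_id : forall n (x : f1_obj n), f1_map (fin_id n) x = x;
  f1_map_comp : forall n m p (psi : fin_map m p) (phi : fin_map n m)
    (x : f1_obj n), f1_map (fin_comp psi phi) x = f1_map psi (f1_map phi x);
  f1_obj0 : forall x : f1_obj 0, x = point (f1_obj 0) }.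

Record f1_hom (X Y : f1_module) := F1Hom {
  f1_app :> forall n, X n -> Y n;
  f1_app_point : forall n, f1_app (point (X n)) = point (Y n);
  f1_app_natural : forall n m (phi : fin_map n m) (x : X n),
    f1_app (f1_map phi x) = f1_map phi (f1_app x) }.

Definition f1_iso (X Y : f1_module) (f : f1_hom X Y) : Prop :=
  exists g : f1_hom Y X,
    (forall n, cancel (f n) (g n)) /\ (forall n, cancel (g n) (f n)).

Section Dynkin.
Variable T : finType.

Definition is_dynkin (X : {set {set T}}) : bool :=
  [&& set0 \in X,
      [forall A in X, ~: (A : {set T}) \in X] &
      [forall A in X, forall B in X,
         [disjoint A & B] ==> ((A : {set T}) :|: (B : {set T}) \in X)]].

Lemma is_dynkinP (X : {set {set T}}) :
  reflect [/\ set0 \in X, {in X, forall A : {set T}, ~: A \in X} &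
             {in X &, forall A B : {set T}, [disjoint A & B] -> A :|: B \in X}]
          (is_dynkin X).
Proof.
apply: (iffP and3P) => -[X0 XC XU]; split=> //.
- by move=> A XA; move/forall_inP: XC => /(_ A XA).
- move=> A B XA XB; move/forall_inP: XU => /(_ A XA).
  by move/forall_inP=> /(_ B XB) /implyP.
- by apply/forall_inP.
- apply/forall_inP=> A XA; apply/forall_inP=> B XB; apply/implyP; exact: XU.
Qed.

End Dynkin.

Definition dynk (n : nat) : Type :=
  {X : {set {set 'I_n.+1}} | is_dynkin X}.

Lemma dynk_full_subproof n : is_dynkin [set: {set 'I_n.+1}].
Proof. by apply/is_dynkinP; split=> [|A _|A B _ _ _]; rewrite in_setT. Qed.

Definition dynk_pointed (n : nat) : pointed_set :=
  @PointedSet (dynk n) (exist (fun X => is_dynkin X) _ (dynk_full_subproof n)).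

Definition dynk_push n m (phi : fin_map n m) (X : {set {set 'I_n.+1}}) :
    {set {set 'I_m.+1}} :=
  [set A : {set 'I_m.+1} | phi @^-1: A \in X].

Lemma dynk_push_subproof n m (phi : fin_map n m) (X : dynk n) :
  is_dynkin (dynk_push phi (val X)).
Proof.
case: X => X /= /is_dynkinP[X0 XC XU]; apply/is_dynkinP; split.
- by rewrite inE preimset0.
- by move=> A; rewrite !inE preimsetC; apply: XC.
move=> A B; rewrite !inE preimsetU => XA XB dAB; apply: XU => //.
rewrite -setI_eq0 -preimsetI; move: dAB; rewrite -setI_eq0 => /eqP->.
by rewrite preimset0.
Qed.

Definition dynk_map n m (phi : fin_map n m) (X : dynk n) : dynk m :=
  exist (fun Y => is_dynkin Y) _ (dynk_push_subproof phi X).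

Lemma dynk_map_point n m (phi : fin_map n m) :
  dynk_map phi (point (dynk_pointed n)) = point (dynk_pointed m).
Proof. by apply: val_inj; apply/setP=> A; rewrite !inE. Qed.

Lemma dynk_map_id n (X : dynk n) : dynk_map (fin_id n) X = X.
Proof.
apply: val_inj; apply/setP=> A; rewrite inE.
suff -> : fin_id n @^-1: A = A by [].
by apply/setP=> x; rewrite !inE ffunE.
Qed.

Lemma dynk_map_comp n m p (psi : fin_map m p) (phi : fin_map n m) (X : dynk n) :
  dynk_map (fin_comp psi phi) X = dynk_map psi (dynk_map phi X).
Proof.
apply: val_inj; apply/setP=> A; rewrite !inE.
suff -> : fin_comp psi phi @^-1: A = phi @^-1: (psi @^-1: A) by [].
by apply/setP=> x; rewrite !inE ffunE.
Qed.

Lemma dynk_obj0 (X : dynk_pointed 0) : X = point (dynk_pointed 0).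
Proof.
apply: val_inj; apply/setP=> A; case: X => X /= dX; have [X0 XC _] := is_dynkinP _ dX.
rewrite [RHS]inE; case: (boolP (ord0 \in A)) => A0.
  suff ->: A = ~: set0 by apply: XC.
  by apply/setP=> i; rewrite !inE (ord1 i).
by suff ->: A = set0 by []; apply/setP=> i; rewrite (ord1 i) inE (negPf A0).
Qed.

Definition Dynk : f1_module :=
  @F1Module dynk_pointed dynk_map dynk_map_point dynk_map_id dynk_map_comp
    dynk_obj0.

Section Equivalences.
Variable T : finType.
Implicit Types (E R : {set T * T}) (P : {set {set T}}).

Definition is_equiv E : bool :=
  [&& [forall x, (x, x) \in E],
      [forall x, forall y, ((x, y) \in E) ==> ((y, x) \in E)] &
      [forall x, forall y, forall z,
         ((x, y) \in E) && ((y, z) \in E) ==> ((x, z) \in E)]].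

Lemma is_equivP E :
  reflect [/\ forall x, (x, x) \in E,
              forall x y, (x, y) \in E -> (y, x) \in E &
              forall x y z, (x, y) \in E -> (y, z) \in E -> (x, z) \in E]
          (is_equiv E).
Proof.
apply: (iffP and3P) => -[Er Es Et]; split.
- exact/forallP.
- by move=> x y; move/forallP: Es => /(_ x)/forallP/(_ y)/implyP.
- move=> x y z Exy Eyz; move/forallP: Et => /(_ x)/forallP/(_ y)/forallP/(_ z).
  by rewrite Exy Eyz.
- exact/forallP.
- by apply/forallP=> x; apply/forallP=> y; apply/implyP/Es.
- apply/forallP=> x; apply/forallP=> y; apply/forallP=> z.
  by apply/implyP=> /andP[]; apply: Et.
Qed.

(* The smallest equivalence relation containing R. *)
Definition equiv_gen R : {set T * T} :=
  \bigcap_(E : {set T * T} | is_equiv E && (R \subset E)) E.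

Definition equiv_of_partition P : {set T * T} :=
  [set u | u.2 \in pblock P u.1].

Definition partition_of_equiv E : {set {set T}} :=
  equivalence_partition (fun x y => (x, y) \in E) [set: T].

Lemma equiv_gen_equiv R : is_equiv (equiv_gen R).
Proof.
apply/is_equivP; split.
- by move=> x; apply/bigcapP=> E /andP[/is_equivP[Er _ _] _].
- move=> x y /bigcapP Rxy; apply/bigcapP=> E hE.
  by have /andP[/is_equivP[_ Es _] _] := hE; apply/Es/Rxy.
move=> x y z /bigcapP Rxy /bigcapP Ryz; apply/bigcapP=> E hE.
by have /andP[/is_equivP[_ _ Et] _] := hE; apply: Et (Rxy E hE) (Ryz E hE).
Qed.

Lemma sub_equiv_gen R : R \subset equiv_gen R.
Proof. by apply/bigcapsP=> E /andP[]. Qed.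

Lemma equiv_gen_min R E : is_equiv E -> R \subset E -> equiv_gen R \subset E.
Proof. by move=> eqE sRE; apply: bigcap_inf; rewrite eqE. Qed.

Lemma equiv_gen_id E : is_equiv E -> equiv_gen E = E.
Proof.
by move=> eqE; apply/eqP; rewrite eqEsubset sub_equiv_gen equiv_gen_min.
Qed.

Lemma equiv_of_partition_equiv P :
  partition P [set: T] -> is_equiv (equiv_of_partition P).
Proof.
move=> partP; have eqP := pblock_equivalence partP.
have inT (x : T) : x \in [set: T] by rewrite inE.
have rP (x : T) := (eqP x x x (inT x) (inT x) (inT x)).1.
apply/is_equivP; split=> [x|x y|x y z]; rewrite !inE /= ?rP //.
  by move=> xy; rewrite -((eqP x y x (inT _) (inT _) (inT _)).2 xy) rP.
by move=> xy; rewrite ((eqP x y z (inT _) (inT _) (inT _)).2 xy).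
Qed.

Lemma equivalence_rel_of_equiv E : is_equiv E ->
  {in [set: T] & &, equivalence_rel (fun x y => (x, y) \in E)}.
Proof.
move=> /is_equivP[Er Es Et] x y z _ _ _; split=> // Exy.
by apply/idP/idP; apply: Et => //; apply: Es.
Qed.

Lemma partition_of_equivP E :
  is_equiv E -> partition (partition_of_equiv E) [set: T].
Proof. by move/equivalence_rel_of_equiv/equivalence_partitionP. Qed.

Lemma partition_of_equivK E :
  is_equiv E -> equiv_of_partition (partition_of_equiv E) = E.
Proof.
move/equivalence_rel_of_equiv=> eqE; apply/setP=> -[x y].
by rewrite inE pblock_equivalence_partition ?inE.
Qed.

Lemma equiv_of_partitionK P :
  partition P [set: T] -> partition_of_equiv (equiv_of_partition P) = P.
Proof.
move=> partP; rewrite -[RHS](equivalence_partition_pblock partP).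
by apply: eq_imset => x; apply/setP=> y; rewrite !inE.
Qed.

Definition discrete_partition : {set {set T}} := [set [set x] | x : T].

Lemma discrete_partition_equiv :
  discrete_partition = partition_of_equiv [set u | u.1 == u.2].
Proof.
apply/setP=> B; apply/imsetP/imsetP => -[x _ ->];
  by exists x; rewrite ?inE //; apply/setP=> y; rewrite !inE eq_sym.
Qed.

Lemma diag_equiv : is_equiv [set u : T * T | u.1 == u.2].
Proof.
apply/is_equivP; split=> [x|x y|x y z]; rewrite !inE //=.
  by rewrite eq_sym.
by move=> /eqP->.
Qed.

Lemma discrete_partitionP : partition discrete_partition [set: T].
Proof.
by rewrite discrete_partition_equiv partition_of_equivP ?diag_equiv.
Qed.

Lemma equiv_of_discrete_partition :
  equiv_of_partition discrete_partition = [set u | u.1 == u.2].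
Proof.
by rewrite discrete_partition_equiv partition_of_equivK ?diag_equiv.
Qed.

End Equivalences.

Definition part (n : nat) : Type :=
  {P : {set {set 'I_n.+1}} | partition P [set: 'I_n.+1]}.

Definition part_pointed (n : nat) : pointed_set :=
  @PointedSet (part n) (exist (fun P => partition P [set: 'I_n.+1]) _ (discrete_partitionP 'I_n.+1)).

Definition rel_image (T U : finType) (f : T -> U) (E : {set T * T}) :
    {set U * U} :=
  [set (f u.1, f u.2) | u in E].

Definition part_push n m (phi : fin_map n m) (P : {set {set 'I_n.+1}}) :
    {set {set 'I_m.+1}} :=
  partition_of_equiv (equiv_gen (rel_image phi (equiv_of_partition P))).

Lemma part_push_subproof n m (phi : fin_map n m) (P : part n) :
  partition (part_push phi (val P)) [set: 'I_m.+1].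
Proof. exact/partition_of_equivP/equiv_gen_equiv. Qed.

Definition part_map n m (phi : fin_map n m) (P : part n) : part m :=
  exist (fun Q => partition Q [set: 'I_m.+1]) _ (part_push_subproof phi P).

Lemma part_map_point n m (phi : fin_map n m) :
  part_map phi (point (part_pointed n)) = point (part_pointed m).
Proof.
apply: val_inj; rewrite /= /part_push equiv_of_discrete_partition.
rewrite [RHS]discrete_partition_equiv; congr partition_of_equiv.
apply/eqP; rewrite eqEsubset equiv_gen_min ?diag_equiv //=; last first.
  by apply/subsetP=> _ /imsetP[[x y] /[!inE]/= /eqP-> ->].
have /is_equivP[Er _ _] := equiv_gen_equiv
  (rel_image phi [set u : 'I_n.+1 * 'I_n.+1 | u.1 == u.2]).
by apply/subsetP=> -[x y] /[!inE]/= /eqP->.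
Qed.

Lemma part_map_id n (P : part n) : part_map (fin_id n) P = P.
Proof.
case: P => P partP; apply: val_inj; rewrite /= /part_push.
suff ->: rel_image (fin_id n) (equiv_of_partition P) = equiv_of_partition P.
  by rewrite equiv_gen_id ?equiv_of_partition_equiv // equiv_of_partitionK.
apply/setP=> -[x y]; apply/imsetP/idP => [[[a b] Pab [-> ->]]|Pxy].
  by rewrite !ffunE.
by exists (x, y) => //=; rewrite !ffunE.
Qed.

Lemma part_map_comp n m p (psi : fin_map m p) (phi : fin_map n m) (P : part n) :
  part_map (fin_comp psi phi) P = part_map psi (part_map phi P).
Proof.
apply: val_inj; rewrite /= /part_push partition_of_equivK ?equiv_gen_equiv //.
congr partition_of_equiv; set R := equiv_of_partition _.
apply/eqP; rewrite eqEsubset !equiv_gen_min ?equiv_gen_equiv //.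
  set E := equiv_gen (rel_image (fin_comp psi phi) R).
  have /is_equivP[Er Es Et] : is_equiv E by apply: equiv_gen_equiv.
  pose F := [set u : 'I_m.+1 * 'I_m.+1 | (psi u.1, psi u.2) \in E].
  have sF : equiv_gen (rel_image phi R) \subset F.
    apply: equiv_gen_min.
      apply/is_equivP; split=> [x|x y|x y z]; rewrite !inE //=; first exact: Es.
      exact: Et.
    apply/subsetP=> _ /imsetP[[x y] Rxy ->]; rewrite inE /=.
    apply: (subsetP (sub_equiv_gen _)); apply/imsetP; exists (x, y) => //=.
    by rewrite !ffunE.
  by apply/subsetP=> _ /imsetP[u /(subsetP sF) + ->]; rewrite inE.
apply/subsetP=> _ /imsetP[[x y] Rxy ->] /=; rewrite !ffunE.
apply: (subsetP (sub_equiv_gen _)); apply/imsetP; exists (phi x, phi y) => //.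
by apply: (subsetP (sub_equiv_gen _)); apply/imsetP; exists (x, y).
Qed.

Lemma part_obj0 (P : part_pointed 0) : P = point (part_pointed 0).
Proof.
case: P => P partP; apply: val_inj; rewrite /= -(equiv_of_partitionK partP).
rewrite discrete_partition_equiv; congr partition_of_equiv.
have /is_equivP[Er _ _] := equiv_of_partition_equiv partP.
by apply/setP=> -[x y]; rewrite (ord1 x) (ord1 y) Er inE.
Qed.

Definition Part : f1_module :=
  @F1Module part_pointed part_map part_map_point part_map_id part_map_comp
    part_obj0.

Definition Sigma (T : finType) (P : {set {set T}}) : {set {set T}} :=
  [set cover S | S in powerset P].

(* On a finite set, countable unions are iterated binary unions. *)
Definition is_sigma_algebra (T : finType) (X : {set {set T}}) : bool :=
  [&& set0 \in X,
      [forall A in X, ~: (A : {set T}) \in X] &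
      [forall A in X, forall B in X,
         ((A : {set T}) :|: (B : {set T}) \in X)]].

Lemma Sigma_generated (T : finType) (P : {set {set T}}) :
  partition P [set: T] ->
  Sigma P = \bigcap_(X : {set {set T}} | is_sigma_algebra X && (P \subset X)) X.
Proof.
move=> partP; have /and3P[/eqP covP tiP _] := partP.
apply/eqP; rewrite eqEsubset; apply/andP; split.
  apply/bigcapsP=> X /andP[/and3P[X0 _ /forall_inP XU] sPX].
  apply/subsetP=> _ /imsetP[S /[!inE] sSP ->]; rewrite /cover.
  apply: (big_ind (fun A : {set T} => A \in X)) => // [A B XA XB|B SB].
    by have /forall_inP := XU A XA; apply.
  exact: (subsetP sPX) (subsetP sSP _ SB).
have sP (S : {set {set T}}) : S \subset P -> cover S \in Sigma P.
  by move=> sSP; apply/imsetP; exists S; rewrite ?inE.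
apply: bigcap_inf; apply/andP; split; last first.
  by apply/subsetP=> B PB; rewrite -[B]cover1 sP ?sub1set.
apply/and3P; split.
- by have := sP set0 (sub0set P); rewrite /cover big_set0.
- apply/forall_inP=> _ /imsetP[S /[!inE] sSP ->].
  suff -> : ~: cover S = cover (P :\: S) by rewrite sP ?subsetDl.
  have covU : cover (P :\: S) :|: cover S = [set: T].
    by rewrite setUC /cover -bigcup_setU -{1}(setIidPr sSP) setID.
  have dis : [disjoint cover (P :\: S) & cover S].
    rewrite -setI_eq0; apply/eqP/setP=> x; rewrite !inE; apply/negP.
    move=> /andP[/bigcupP[B /setDP[PB nSB] Bx] /bigcupP[C SC Cx]].
    have PC := subsetP sSP _ SC; move: nSB.
    by rewrite -(def_pblock tiP PB Bx) (def_pblock tiP PC Cx) SC.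
  apply/setP=> x; have := in_setT x; rewrite -covU !inE.
  case: (boolP (x \in cover (P :\: S))) => [xc _|_ /= ->//].
  by rewrite (disjointFr dis xc).
apply/forall_inP=> _ /imsetP[S /[!inE] sSP ->].
apply/forall_inP=> _ /imsetP[S' /[!inE] sS'P ->].
by rewrite /cover -bigcup_setU sP // subUset sSP.
Qed.

(* Main.v *)
Require Import Defs.
From mathcomp Require Import all_boot.

(** A subset [A] and an equivalence relation [E] are compatible when [E] is
    contained in the two-class relation having the same members of [A]
    ([same_side A]).  A union of blocks of [P] is exactly a set compatible with
    the relation of [P] ([mem_Sigma]), and this description turns everything
    about [Sigma] into inclusions of relations.

    Naturality: as [same_side A] is itself an equivalence relation, containing
    a relation [R] is the same as containing the equivalence relation generated
    by [R]; and it contains the image of [R] under [phi] iff the relation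
    [same_side (phi @^-1: A)] contains [R].  So [A] is a union of blocks of the
    pushed partition iff its preimage is a union of blocks of the original one.

    Injectivity: the relation of [P] is the intersection of the relations
    [same_side A] for [A] in [Sigma P], since the blocks themselves belong to
    [Sigma P].

    Not an isomorphism: every [Sigma P] is closed under binary intersections,
    whereas the subsets of even cardinality of a set with four elements form a
    Dynkin system that is not: {0, 1} and {0, 2} meet in a single point. *)

Set Implicit Arguments.
Unset Strict Implicit.
Unset Printing Implicit Defensive.

Definition same_side (T : finType) (A : {set T}) : {set T * T} :=
  [set u | (u.1 \in A) == (u.2 \in A)].

Lemma same_side_equiv (T : finType) (A : {set T}) : is_equiv (same_side A).
Proof.
apply/is_equivP; split=> [x|x y|x y z]; rewrite !inE //=; first by rewrite eq_sym.
by move=> /eqP->.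
Qed.

Lemma equiv_gen_sub (T : finType) (R E : {set T * T}) :
  is_equiv E -> (equiv_gen R \subset E) = (R \subset E).
Proof.
move=> eqE; apply/idP/idP; last exact: equiv_gen_min.
exact/subset_trans/sub_equiv_gen.
Qed.

(** The relation [same_side (f @^-1: A)] is the preimage of [same_side A] under
    [f] acting on pairs, and image is left adjoint to preimage. *)
Lemma rel_image_sub_same_side (T U : finType) (f : T -> U) (R : {set T * T})
    (A : {set U}) :
  (rel_image f R \subset same_side A) = (R \subset same_side (f @^-1: A)).
Proof.
apply/subsetP/subsetP => sR.
  by move=> u Ru; have := sR _ (imset_f _ Ru); rewrite !inE.
by move=> _ /imsetP[u /sR + ->]; rewrite !inE.
Qed.

Section SigmaOfPartition.
Variables (T : finType) (P : {set {set T}}).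
Hypothesis partP : partition P [set: T].

Lemma mem_pblockT (x : T) : x \in pblock P x.
Proof. by rewrite mem_pblock (cover_partition partP) inE. Qed.

(** Moving inside a block does not change membership in a union of blocks.
    Conversely, a set compatible with the relation of [P] contains the whole
    block of each of its points, so it is the union of the blocks it contains. *)
Lemma mem_Sigma (A : {set T}) :
  (A \in Sigma P) = (equiv_of_partition P \subset same_side A).
Proof.
have [_ tiP _] := and3P partP.
apply/imsetP/subsetP => [[S /[!inE] /subsetP sSP ->] [x y]|sA].
  rewrite !inE /= => yx; have exy := same_pblock tiP yx.
  have inS z : (z \in cover S) = (pblock P z \in S).
    apply/bigcupP/idP => [[B SB Bz]|SB]; first by rewrite (def_pblock tiP (sSP B SB) Bz).
    by exists (pblock P z); rewrite ?mem_pblockT.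
  by rewrite !inS exy.
exists [set B in P | B \subset A].
  by rewrite inE; apply/subsetP=> B /[!inE] /andP[].
apply/setP=> x; apply/idP/bigcupP => [Ax|[B /[!inE] /andP[_ /subsetP sBA] /sBA//]].
exists (pblock P x); last exact: mem_pblockT.
rewrite inE pblock_mem ?(cover_partition partP) ?inE //=.
apply/subsetP=> y xy; have := sA (x, y).
by rewrite !inE /= Ax => /(_ xy)/eqP<-.
Qed.

Lemma block_in_Sigma (B : {set T}) : B \in P -> B \in Sigma P.
Proof. by move=> PB; apply/imsetP; exists [set B]; rewrite ?inE ?sub1set // cover1. Qed.

Lemma Sigma_setI (A B : {set T}) :
  A \in Sigma P -> B \in Sigma P -> A :&: B \in Sigma P.
Proof.
rewrite !mem_Sigma => /subsetP sA /subsetP sB; apply/subsetP=> u Eu.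
by have := sA u Eu; have := sB u Eu; rewrite !inE => /eqP-> /eqP->.
Qed.

(** Taking [A] to be the block of [x] shows that the intersection relates [x]
    to no point outside that block. *)
Lemma equiv_of_partition_Sigma :
  equiv_of_partition P = \bigcap_(A in Sigma P) same_side A.
Proof.
apply/eqP; rewrite eqEsubset; apply/andP; split.
  by apply/bigcapsP=> A; rewrite mem_Sigma.
apply/subsetP=> -[x y] /bigcapP /(_ (pblock P x)).
rewrite !inE /= mem_pblockT => /(_ _)/eqP <- //.
by rewrite block_in_Sigma // pblock_mem // (cover_partition partP) inE.
Qed.

Lemma Sigma_dynkin : is_dynkin (Sigma P).
Proof.
apply/is_dynkinP; split=> [|A|A B]; rewrite !mem_Sigma.
- by apply/subsetP=> u _; rewrite !inE.
- by move=> /subsetP sA; apply/subsetP=> u /sA; rewrite !inE => /eqP->.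
move=> /subsetP sA /subsetP sB _; apply/subsetP=> u Eu.
by have := sA u Eu; have := sB u Eu; rewrite !inE => /eqP-> /eqP->.
Qed.

End SigmaOfPartition.

Lemma Sigma_inj (T : finType) (P Q : {set {set T}}) :
  partition P [set: T] -> partition Q [set: T] -> Sigma P = Sigma Q -> P = Q.
Proof.
move=> partP partQ eqPQ.
rewrite -(equiv_of_partitionK partP) -(equiv_of_partitionK partQ).
by rewrite !equiv_of_partition_Sigma // eqPQ.
Qed.

(** A set is compatible with the pushed relation iff it is compatible with the
    image that generates it, iff its preimage is compatible with the relation
    of [P]. *)
Lemma Sigma_part_push n m (phi : fin_map n m) (P : part n) :
  Sigma (part_push phi (val P)) = dynk_push phi (Sigma (val P)).
Proof.
apply/setP=> A; rewrite inE !mem_Sigma ?(valP P) ?(part_push_subproof phi P) //.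
rewrite partition_of_equivK ?equiv_gen_equiv // equiv_gen_sub ?same_side_equiv //.
exact: rel_image_sub_same_side.
Qed.

(** This is the compatibility of [Sigma] with base points. *)
Lemma Sigma_discrete (T : finType) : Sigma (discrete_partition T) = [set: {set T}].
Proof.
apply/setP=> A; rewrite inE mem_Sigma ?discrete_partitionP //.
rewrite equiv_of_discrete_partition.
by apply/subsetP=> u; rewrite !inE => /eqP->.
Qed.

Definition sigma_app n (P : Part n) : Dynk n :=
  exist (fun X => is_dynkin X) (Sigma (val P)) (Sigma_dynkin (valP P)).

Lemma sigma_app_point n : sigma_app (point (Part n)) = point (Dynk n).
Proof. by apply: val_inj; apply: Sigma_discrete. Qed.

Lemma sigma_app_natural n m (phi : fin_map n m) (P : Part n) :
  sigma_app (f1_map phi P) = f1_map phi (sigma_app P).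
Proof. by apply: val_inj; apply: Sigma_part_push. Qed.

Definition sigma_hom : f1_hom Part Dynk := F1Hom sigma_app_point sigma_app_natural.

Lemma sigma_app_inj n : injective (@sigma_app n).
Proof.
by move=> P Q /(congr1 val)/= eqPQ; apply: val_inj; exact: Sigma_inj (valP P) (valP Q) eqPQ.
Qed.

Definition even_sets (T : finType) : {set {set T}} := [set A : {set T} | ~~ odd #|A|].

(** Disjoint unions add cardinalities; complements preserve parity because the
    ambient cardinality is even. *)
Lemma even_sets_dynkin (T : finType) : ~~ odd #|T| -> is_dynkin (even_sets T).
Proof.
move=> evT; apply/is_dynkinP; split=> [|A|A B]; rewrite !inE ?cards0 //.
  by move=> evA; move: evT; rewrite -(cardsC A) oddD (negPf evA).
move=> evA evB; rewrite -setI_eq0 => /eqP AB0.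
by rewrite cardsU AB0 cards0 subn0 oddD (negPf evA) (negPf evB).
Qed.

(** The even sets {x, y} and {x, z} meet in the odd set {x}. *)
Lemma even_sets_not_Sigma (T : finType) (x y z : T) (P : {set {set T}}) :
  uniq [:: x; y; z] -> partition P [set: T] -> Sigma P <> even_sets T.
Proof.
rewrite /= !inE negb_or andbT => /andP[/andP[xy xz] yz] partP eqSigma.
have pairIn (t : T) : x != t -> [set x; t] \in Sigma P.
  by move=> xt; rewrite eqSigma inE cards2 xt.
have := Sigma_setI partP (pairIn y xy) (pairIn z xz).
have ->: [set x; y] :&: [set x; z] = [set x].
  by rewrite -setUIr; apply/setUidPl/subsetP=> t /[!inE] /andP[/eqP->]; rewrite (negPf yz).
by rewrite eqSigma inE cards1.
Qed.

Theorem theorem5p4 :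
  exists f : f1_hom Part Dynk,
    (forall (n : nat) (P : part n), sval (f n P) = Sigma (sval P)) /\
    (forall n : nat, injective (f n)) /\
    ~ f1_iso f.
Proof.
exists sigma_hom; split=> //; split; first exact: sigma_app_inj.
move=> [g [_ gK]].
have ev4 : ~~ odd #|'I_4| by rewrite card_ord.
pose D : Dynk 3 := exist (fun X => is_dynkin X) _ (even_sets_dynkin ev4).
have eqD : Sigma (sval (g 3 D)) = even_sets 'I_4 := congr1 val (gK 3 D).
have uniq012 : uniq [:: inord 0; inord 1; inord 2 : 'I_4].
  by rewrite /= !inE -!val_eqE /= !inordK.
exact: even_sets_not_Sigma uniq012 (svalP (g 3 D)) eqD.
Qed.
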